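(* Let $T,U\in\mathcal{GB}(H)$, and let $S_{T\Lambda\Gamma U}$ be the frame operator for a pair consisting of a $(T,T)$-controlled $g$-fusion Bessel sequence $\Lambda_T=\{(W_j,\Lambda_j,w_j)\}_{j\in J}$ and a $(U,U)$-controlled $g$-fusion Bessel sequence $\Gamma_U=\{(V_j,\Gamma_j,v_j)\}_{j\in J}$ in $H$, with bounds $D_1$ and $D_2$, respectively. Suppose $\lambda_1<1$ and $\lambda_2>-1$ are such that for each $f\in H$, $$\|f-S_{T\Lambda\Gamma U}f\|\le\lambda_1\|f\|+\lambda_2\|S_{T\Lambda\Gamma U}f\|.$$ Then $\Gamma_U$ is a $(U,U)$-controlled $g$-fusion frame for $H$.
   Context: $H$ is a separable Hilbert space, $J\subset\mathbb{Z}$, $\{H_j\}_{j\in J}$ is a collection of Hilbert spaces, $W_j,V_j\subset H$ are closed subspaces, $w_j,v_j>0$ are weights, and $\Lambda_j,\Gamma_j\in\mathcal{B}(H,H_j)$ (bounded linear operators). $\mathcal{GB}(H)$ is the set of bounded linear operators on $H$ having a bounded inverse. $P_M$ is the orthogonal projection onto a closed subspace $M$. For $R\in\mathcal{GB}(H)$, a family $\{(M_j,\Theta_j,u_j)\}_{j\in J}$ ($M_j\subset H$ closed subspaces, $\Theta_j\in\mathcal{B}(H,H_j)$, $u_j>0$) is an $(R,R)$-controlled $g$-fusion frame for $H$ if there are $0<a\le b<\infty$ with $$a\|f\|^2\le\sum_{j\in J}u_j^2\langle\Theta_jP_{M_j}Rf,\Theta_jP_{M_j}Rf\rangle\le b\|f\|^2\quad\text{for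 all } f\in H;$$ it is an $(R,R)$-controlled $g$-fusion Bessel sequence with bound $b$ if the right-hand inequality holds. The frame operator of the pair $\Lambda_T,\Gamma_U$ is the bounded operator $$S_{T\Lambda\Gamma U}f=\sum_{j\in J}v_jw_jT^*P_{W_j}\Lambda_j^*\Gamma_jP_{V_j}Uf,\quad f\in H.$$ *)

(* Defs.v *)
From HB Require Import structures.
From mathcomp Require Import all_boot all_order all_algebra.
From mathcomp Require Import all_classical all_reals all_analysis.
From mathcomp Require Import complex.
From mathcomp Require Import showcase.summability.
Import Order.TTheory GRing.Theory Num.Theory.
Import numFieldNormedType.Exports.

Set Implicit Arguments.
Unset Strict Implicit.
Unset Printing Implicit Defensive.

Local Open Scope classical_set_scope.
Local Open Scope ring_scope.

(** Hilbert spaces may be real or complex: the scalar field is [R] or [R[i]]. *)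
Variant scalar_kind := RealScalars | ComplexScalars.

Definition scalarField (R : realType) (k : scalar_kind) : numFieldType :=
  match k with
  | RealScalars => R
  | ComplexScalars => R[i]
  end.

Definition sconj (R : realType) (k : scalar_kind) :
  scalarField R k -> scalarField R k :=
  match k with
  | RealScalars => fun x => x
  | ComplexScalars => @conjc R
  end.

Definition sre (R : realType) (k : scalar_kind) : scalarField R k -> R :=
  match k with
  | RealScalars => fun x => x
  | ComplexScalars => @complex.Re R
  end.

Definition of_real (R : realType) (k : scalar_kind) : R -> scalarField R k :=
  match k with
  | RealScalars => fun x => x
  | ComplexScalars => @real_complex_def R (Phant R)
  end.

(** [inner] is linear in its first argument and conjugate-linear in the second;
    [inner_norm] makes the norm of the normed module the inner-product norm. *)
HB.mixin Record isHilbert (R : realType) (k : scalar_kind) (H : Type)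
    of CompleteNormedModule (scalarField R k) H := {
  inner : {dot H for @sconj R k} ;
  inner_norm : forall x : H, inner x x = `|x| ^+ 2
}.

#[short(type="hilbertType")]
HB.structure Definition Hilbert (R : realType) (k : scalar_kind) :=
  { H of CompleteNormedModule (scalarField R k) H & isHilbert R k H }.

Section HilbertSpaces.
Variables (R : realType) (k : scalar_kind).
Implicit Types H : hilbertType R k.

(** The library norm takes its values in the scalar field; it is real there,
    so taking the real part loses nothing. *)
Definition hnorm H (x : H) : R := sre `|x|.

Definition separable H := exists D : set H, countable D /\ dense D.

Definition closed_subspace H (M : set H) :=
  [/\ M 0,
      forall (a : scalarField R k) x y, M x -> M y -> M (a *: x + y)
    & closed M].

Definition bounded_op H1 H2 (A : {linear H1 -> H2}) :=
  exists c : R, forall x, hnorm (A x) <= c * hnorm x.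

Definition GB H (A : {linear H -> H}) :=
  bounded_op A /\
  exists B : {linear H -> H}, [/\ bounded_op B, cancel A B & cancel B A].

(** The vector [z] with [<A x, y> = <x, z>] for all [x]; it exists and is unique
    (Riesz) when [A] is bounded, and the default [0] is not reached. *)
Definition adjoint H1 H2 (A : {linear H1 -> H2}) (y : H2) : H1 :=
  xget 0 [set z | forall x, inner (A x) y = inner x z].

(** The vector [y] of [M] with [x - y] orthogonal to [M]; it exists and is unique
    when [M] is a closed subspace. *)
Definition proj H (M : set H) (x : H) : H :=
  xget 0 [set y | M y /\ forall z, M z -> inner (x - y) z = 0].

(** Families are indexed by the subtype of integers lying in [J]. *)
Variables (H : hilbertType R k) (J : set int) (K : J -> hilbertType R k).

(** The inner product of a vector with itself is real, whence [sre]; the sum of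
    these nonnegative terms is taken in the extended reals. *)
Definition g_fusion_sum (A : {linear H -> H}) (M : J -> set H)
    (Theta : forall j, {linear H -> K j}) (u : J -> R) (f : H) : \bar R :=
  \esum_(j in [set: J])
    (u j ^+ 2 * sre (inner (Theta j (proj (M j) (A f)))
                           (Theta j (proj (M j) (A f)))))%:E.

Definition controlled_g_fusion_frame (A : {linear H -> H}) (M : J -> set H)
    (Theta : forall j, {linear H -> K j}) (u : J -> R) :=
  exists a b : R, [/\ 0 < a, a <= b &
    forall f : H,
      ((a * hnorm f ^+ 2)%:E <= g_fusion_sum A M Theta u f)%E /\
      (g_fusion_sum A M Theta u f <= (b * hnorm f ^+ 2)%:E)%E].

Definition controlled_g_fusion_Bessel (A : {linear H -> H}) (M : J -> set H)
    (Theta : forall j, {linear H -> K j}) (u : J -> R) (b : R) :=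
  0 < b /\
  forall f : H, (g_fusion_sum A M Theta u f <= (b * hnorm f ^+ 2)%:E)%E.

(** [sum] is the norm limit of the sums over finite subsets of the index type
    (unconditional convergence). *)
Definition frame_operator
    (T : {linear H -> H}) (W : J -> set H)
    (Lambda : forall j, {linear H -> K j}) (w : J -> R)
    (U : {linear H -> H}) (V : J -> set H)
    (Gamma : forall j, {linear H -> K j}) (v : J -> R) (f : H) : H :=
  sum (fun j : J =>
    of_real k (v j * w j) *:
      adjoint T (proj (W j) (adjoint (Lambda j)
        (Gamma j (proj (V j) (U f)))))).

End HilbertSpaces.

(* Main.v *)
(* The hypothesis gives (1 - lambda1) |f| <= (1 + lambda2) |S f|, so S is bounded
    below and it suffices to bound |S f|^2 by D1 times the sum a(f) of the terms
    v_j^2 |Gamma_j P_{V_j} U f|^2. For a finite partial sum s of S f and real t,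
    moving adjoints and projections onto s and using 2 <x, y> <= |x|^2 + |y|^2
    termwise gives 2 t |s|^2 <= t^2 D1 |s|^2 + a(f); t = 1/D1 yields
    |s|^2 <= D1 a(f). The same estimate on tails shows that the partial sums are
    Cauchy, hence that the series for S f converges and the bound passes to the
    limit. *)

Require Import Defs.
From mathcomp Require Import all_boot all_order all_algebra.
From mathcomp Require Import all_classical all_reals all_analysis.
From mathcomp Require Import finmap complex ring lra.
From mathcomp Require Import showcase.summability.
Import Order.TTheory GRing.Theory Num.Theory.
Import numFieldNormedType.Exports.

Local Open Scope classical_set_scope.
Local Open Scope ring_scope.

(** * Real parts and the real embedding in the scalar field *)

Section Scalars.
Set Implicit Arguments.
Unset Strict Implicit.
Context {R : realType} {k : scalar_kind}.
Implicit Types a b : scalarField R k.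

Lemma sreD : {morph @sre R k : a b / a + b}.
Proof. by case: k => // -[? ?] [? ?]. Qed.

Lemma sreN : {morph @sre R k : a / - a}.
Proof. by case: k => // -[? ?]. Qed.

Lemma sre0 : @sre R k 0 = 0.
Proof. by case: k. Qed.

Lemma sre_of_realM (c : R) a : sre (of_real k c * a) = c * sre a.
Proof. by case: k a => // -[x y] /=; rewrite mul0r subr0. Qed.

Lemma sre_sconj a : sre (sconj a) = sre a.
Proof. by case: k a => // -[]. Qed.

(** The product is the squared modulus. This recovers vanishing of a full inner product from
    vanishing of real parts. *)
Lemma sre_sconjM_eq0 a : sre (sconj a * a) = 0 -> a = 0.
Proof.
case: k a => [x /eqP|[x y] /=]; first by rewrite mulf_eq0 orbb => /eqP.
move=> /eqP; rewrite mulNr opprK -!expr2 paddr_eq0 ?sqr_ge0// !sqrf_eq0.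
by move=> /andP[/eqP-> /eqP->].
Qed.

Lemma sreK a : 0 <= a -> of_real k (sre a) = a.
Proof. by case: k a => // -[x y]; rewrite lecE /= => /andP[/eqP-> _]. Qed.

Lemma sre_ge0 a : 0 <= a -> 0 <= sre a.
Proof. by case: k a => // -[x y]; rewrite lecE /= => /andP[]. Qed.

Lemma sre_gt0 a : 0 < a -> 0 < sre a.
Proof. by case: k a => // -[x y]; rewrite ltcE /= => /andP[]. Qed.

Lemma sre_le a b : a <= b -> sre a <= sre b.
Proof. by case: k a b => // -[x y] [u t]; rewrite lecE /= => /andP[]. Qed.

Lemma of_real_lt (c d : R) : (of_real k c < of_real k d) = (c < d).
Proof. by case: k => //=; rewrite ltcE /= eqxx. Qed.

Lemma of_real_gt0 (c : R) : (0 < of_real k c) = (0 < c).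
Proof. by case: k => //=; rewrite ltcE /= eqxx. Qed.

End Scalars.

(** * Real inner-product geometry, orthogonal projections and adjoints *)

Section RealInner.
Set Implicit Arguments.
Unset Strict Implicit.
Context {R : realType} {k : scalar_kind}.
Implicit Types H : hilbertType R k.
Local Notation proj := (@Defs.proj R k _).

(* The real part of the inner product: a real bilinear symmetric form inducing
   the same norm, so that real and complex scalars are treated alike. *)
Definition rip {H} (x y : H) : R := sre (inner x y).

Lemma ripDl H (y : H) : {morph rip^~ y : x z / x + z}.
Proof. by move=> x z; rewrite /rip linearDl sreD. Qed.

Lemma ripNl H (y : H) : {morph rip^~ y : x / - x}.
Proof. by move=> x; rewrite /rip linearNl sreN. Qed.

Lemma ripC H (x y : H) : rip x y = rip y x.
Proof. by rewrite /rip hermitian_subproof expr0 mul1r sre_sconj. Qed.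

Lemma rip_scalel H (c : R) (x y : H) : rip (of_real k c *: x) y = c * rip x y.
Proof. by rewrite /rip linearZl_LR /= sre_of_realM. Qed.

Lemma ripxx H (x : H) : rip x x = hnorm x ^+ 2.
Proof.
rewrite /rip inner_norm expr2 -[X in sre (X * _)]sreK//.
by rewrite sre_of_realM -expr2.
Qed.

Lemma rip0l H (y : H) : rip 0 y = 0.
Proof. by rewrite /rip linear0l sre0. Qed.

Lemma rip0r H (y : H) : rip y 0 = 0.
Proof. by rewrite ripC rip0l. Qed.

Lemma ripDr H (x : H) : {morph rip x : y z / y + z}.
Proof. by move=> y z; rewrite !(ripC x) ripDl. Qed.

Lemma ripNr H (x : H) : {morph rip x : y / - y}.
Proof. by move=> y; rewrite !(ripC x) ripNl. Qed.

Lemma rip_scaler H (c : R) (x y : H) : rip x (of_real k c *: y) = c * rip x y.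
Proof. by rewrite ripC rip_scalel ripC. Qed.

Lemma rip_sumr H (I : Type) (r : seq I) (x : H) (y : I -> H) :
  rip x (\sum_(i <- r) y i) = \sum_(i <- r) rip x (y i).
Proof. exact: (big_morph _ (ripDr x) (rip0r x)). Qed.

Lemma hnormK H (x : H) : of_real k (hnorm x) = `|x|.
Proof. exact: sreK. Qed.

Lemma hnorm_ge0 H (x : H) : 0 <= hnorm x.
Proof. exact: sre_ge0. Qed.

Lemma hnorm_opp H (x : H) : hnorm (- x) = hnorm x.
Proof. by rewrite /hnorm normrN. Qed.

Lemma hnorm_distC H (x y : H) : hnorm (x - y) = hnorm (y - x).
Proof. by rewrite -hnorm_opp opprB. Qed.

Lemma ler_hnormD H (x y : H) : hnorm (x + y) <= hnorm x + hnorm y.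
Proof. by rewrite /hnorm -sreD sre_le ?ler_normD. Qed.

Lemma ler_hnorm_distD H (x y z : H) :
  hnorm (x - z) <= hnorm (x - y) + hnorm (y - z).
Proof. by rewrite (le_trans _ (ler_hnormD _ _))// addrA subrK. Qed.

Lemma hnorm_sqD H (x y : H) :
  hnorm (x + y) ^+ 2 = hnorm x ^+ 2 + 2 * rip x y + hnorm y ^+ 2.
Proof. by rewrite -!ripxx ripDl !ripDr (ripC y x); ring. Qed.

Lemma hnorm_sqZ H (c : R) (x : H) :
  hnorm (of_real k c *: x) ^+ 2 = c ^+ 2 * hnorm x ^+ 2.
Proof. by rewrite -!ripxx rip_scalel rip_scaler; ring. Qed.

Lemma rip_le H (x y : H) : 2 * rip x y <= hnorm x ^+ 2 + hnorm y ^+ 2.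
Proof.
have := sqr_ge0 (hnorm (x - y)).
by rewrite hnorm_sqD ripNr hnorm_opp; lra.
Qed.

Lemma nbhs_hnorm H (x : H) (e : R) :
  0 < e -> \forall y \near x, hnorm (x - y) < e.
Proof.
move=> e0; apply/nbhs_normP; exists (of_real k e).
  by rewrite /= of_real_gt0.
by move=> y; rewrite /= -hnormK of_real_lt.
Qed.

Lemma hnorm_cauchy_cvg H (F : set_system H) {FF : ProperFilter F} :
  (forall e : R, 0 < e -> exists x, \forall y \near F, hnorm (x - y) < e) ->
  cvg F.
Proof.
move=> Fe; apply: cauchy_cvg; apply: cauchy_exP => e e0.
have [x Fx] := Fe _ (sre_gt0 e0); exists x.
apply: filterS Fx => y; rewrite -ball_normE /= => xy.
by rewrite -hnormK -(sreK (ltW e0)) of_real_lt.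
Qed.

(** Stated for an arbitrary filter so as to serve both minimizing filters and nets of finite partial
    sums. *)
Lemma hnorm_lim_le H (F : set_system H) {FF : ProperFilter F}
    (x l : H) (c : R) :
  F --> l -> (\forall y \near F, hnorm (x - y) <= c) -> hnorm (x - l) <= c.
Proof.
move=> Fl Fc; apply/ler_addgt0Pr => e e0.
have Fe : \forall y \near F, hnorm (l - y) < e by exact: Fl (nbhs_hnorm l e0).
have [y [yc ye]] := filter_ex (filterI Fc Fe).
by rewrite (le_trans (ler_hnorm_distD x y l))// lerD// hnorm_distC ltW.
Qed.

(** The parallelogram law for [x - y] and [x - z], whose sum is twice the vector from the midpoint
    to [x]: a lower bound on that distance bounds [hnorm (y - z)] from above. *)
Lemma parallelogram H (x y z : H) :
  hnorm (y - z) ^+ 2 = 2 * hnorm (x - y) ^+ 2 + 2 * hnorm (x - z) ^+ 2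
    - 4 * hnorm (x - of_real k 2^-1 *: (y + z)) ^+ 2.
Proof.
rewrite -!ripxx !(ripDl, ripDr, ripNl, ripNr, rip_scalel, rip_scaler).
by rewrite (ripC y x) (ripC z x) (ripC z y); field.
Qed.

Lemma closed_subspace_mid H (M : set H) (y z : H) :
  closed_subspace M -> M y -> M z -> M (of_real k 2^-1 *: (y + z)).
Proof.
case=> M0 Ml _ My Mz; rewrite -[_ *: _]addr0; apply: (Ml) => //.
by rewrite -[y]scale1r; exact: Ml.
Qed.

(* By the parallelogram identity the sets of almost-minimizers of the distance
   to x have small diameter, so they generate a Cauchy filter. *)
Lemma nearest_point H (M : set H) (x : H) : closed_subspace M ->
  exists2 y, M y & forall z, M z -> hnorm (x - y) <= hnorm (x - z).
Proof.
move=> cM; have [M0 Ml clM] := cM.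
have dist_inf : has_inf [set hnorm (x - z) | z in M].
  split; first by exists (hnorm (x - 0)); exists 0.
  by exists 0 => _ [t _ <-]; exact: hnorm_ge0.
pose D := inf [set hnorm (x - z) | z in M].
have D_lb z : M z -> D <= hnorm (x - z).
  move=> Mz; apply: ge_inf; last by exists z.
  exact: dist_inf.2.
have D0 : 0 <= D.
  by apply: lb_le_inf dist_inf.1 _ => _ [t _ <-]; exact: hnorm_ge0.
pose B (e : R) := [set z | M z /\ hnorm (x - z) < D + e].
have B_ex e : 0 < e -> B e !=set0.
  by move=> e0; have [_ [z Mz <-] ze] := inf_adherent e0 dist_inf; exists z.
pose F := filter_from [set e : R | 0 < e] B.
have FF : ProperFilter F.
  apply: filter_from_proper B_ex; apply: filter_from_filter.
    by exists 1 => /=.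
  move=> e e' /= e0 e'0; exists (Num.min e e'); first by rewrite /= lt_min e0.
  move=> z [Mz] ze; split; split => //; rewrite (lt_le_trans ze)// lerD2l.
    by rewrite ge_min lexx.
  by rewrite ge_min lexx orbT.
have FB e : 0 < e -> F (B e) by move=> e0; exists e.
have Fcvg : cvg F.
  apply: hnorm_cauchy_cvg => e e0.
  (* For [y], [z] in [B d] the squared distance is below [4 (D + d)^2 - 4 D^2 = 8 D d + 4 d^2], at
     most [d (8 D + 4)] since [d <= 1]. *)
  pose d := Num.min 1 (e ^+ 2 / (8 * D + 5)).
  have d0 : 0 < d by rewrite lt_min ltr01 divr_gt0 ?exprn_gt0//; lra.
  have [y [My yd]] := B_ex _ d0; exists y.
  apply: filterS (FB _ d0) => z [Mz zd].
  rewrite -(@ltr_pXn2r _ 2) ?nnegrE ?hnorm_ge0 ?(ltW e0)//.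
  rewrite (parallelogram x).
  have d1 : d <= 1 by rewrite ge_min lexx.
  have de : d * (8 * D + 5) <= e ^+ 2.
    by rewrite -ler_pdivlMr ?ge_min ?lexx ?orbT//; lra.
  have Dm := D_lb _ (closed_subspace_mid cM My Mz).
  have [a0 b0] := (hnorm_ge0 (x - y), hnorm_ge0 (x - z)).
  move: (hnorm (x - y)) (hnorm (x - z)) (hnorm (x - of_real k _ *: _))
    yd zd Dm a0 b0 => a b c ad bd Dc a0 b0.
  clearbody D d.
  have a2 : a ^+ 2 < (D + d) ^+ 2 by rewrite ltr_pXn2r ?nnegrE//; lra.
  have b2 : b ^+ 2 < (D + d) ^+ 2 by rewrite ltr_pXn2r ?nnegrE//; lra.
  have c2 : D ^+ 2 <= c ^+ 2 by rewrite ler_pXn2r ?nnegrE//; lra.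
  have : d ^+ 2 <= d by rewrite expr2 ler_piMr// ltW.
  move: a2 b2 c2 de; rewrite !expr2; nra.
exists (lim F).
  apply: clM => A /Fcvg FA.
  by have [z [Az [Mz _]]] := filter_ex (filterI FA (FB _ ltr01)); exists z.
move=> z Mz; apply: le_trans (D_lb z Mz).
apply/ler_addgt0Pr => e e0.
apply: (hnorm_lim_le Fcvg).
by apply: filterS (FB _ e0) => y [_ /ltW].
Qed.

(** A nearest point has orthogonal residual, by varying it within [M]; so [proj] does not take its
    default value. *)
Lemma proj_spec H (M : set H) (x : H) : closed_subspace M ->
  M (proj M x) /\ forall z, M z -> inner (x - proj M x) z = 0.
Proof.
move=> cM; have [M0 Ml _] := cM.
suff /(xgetPex 0) : exists y, M y /\ forall z, M z -> inner (x - y) z = 0 by [].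
have [y My y_min] := nearest_point x cM.
exists y; split=> // z Mz.
(* Real parts suffice: rescaling [z] by [inner (x - y) z] turns the inner product into a squared
   modulus. *)
suff rip0 z' : M z' -> rip (x - y) z' = 0.
  apply: sre_sconjM_eq0.
  have : M (inner (x - y) z *: z) by rewrite -[_ *: z]addr0; exact: Ml.
  by move=> /rip0; rewrite /rip linearZr_LR.
move=> Mz'; set r := rip _ _.
have le_t t : 2 * t * r <= t ^+ 2 * hnorm z' ^+ 2.
  have : hnorm (x - y) <= hnorm (x - (of_real k t *: z' + y)).
    by apply: y_min; exact: Ml.
  rewrite -(@ler_pXn2r _ 2) ?nnegrE ?hnorm_ge0//.
  rewrite opprD addrCA addrC [leRHS]hnorm_sqD hnorm_opp hnorm_sqZ.
  by rewrite ripNr rip_scaler -/r; lra.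
have N0 : 0 <= hnorm z' ^+ 2 by exact: sqr_ge0.
apply/eqP; rewrite -sqrf_eq0 eq_le sqr_ge0 andbT.
(* With [r = t (N + 1)] the inequality reads [2 t^2 (N + 1) <= t^2 N], forcing [t = 0]; the [+ 1]
   covers [z' = 0]. *)
move: (hnorm z' ^+ 2) N0 le_t => N N0 /(_ (r / (N + 1))).
have : r = r / (N + 1) * (N + 1) by rewrite divfK//; lra.
move: (r / (N + 1)) => t {1 2}-> le_t.
have t2_0 : t ^+ 2 = 0 by have := sqr_ge0 t; rewrite expr2 in le_t *; nra.
by rewrite exprMn t2_0 mul0r.
Qed.

(** Both sides equal [rip (proj M x) (proj M y)], as the residuals are orthogonal to [M]. *)
Lemma rip_proj H (M : set H) (x y : H) : closed_subspace M ->
  rip x (proj M y) = rip (proj M x) y.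
Proof.
move=> cM; have [Mx x_orth] := proj_spec x cM.
have [My y_orth] := proj_spec y cM.
rewrite -[x in LHS](subrK (proj M x)) ripDl {1}/rip x_orth// sre0 add0r.
rewrite -[y in RHS](subrK (proj M y)) ripDr [X in _ = X + _]ripC.
by rewrite [X in X + _]/rip y_orth// sre0 add0r.
Qed.

(* The second case covers the default value of [adjoint]; since it only weakens
   the estimates, the Riesz representation theorem is not needed. *)
Lemma rip_adjoint H1 H2 (A : {linear H1 -> H2}) (x : H1) (y : H2) :
  rip x (adjoint A y) = rip (A x) y \/ adjoint A y = 0.
Proof.
rewrite /adjoint; case: xgetP => [z _ Az|_]; last by right.
by left; rewrite /rip Az.
Qed.

End RealInner.

(** * Unordered summation and convergence *)

Section Summation.
Set Implicit Arguments.
Unset Strict Implicit.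

Lemma big_fsetD_sub (I : choiceType) (V : nmodType) (A B : {fset I})
    (F : I -> V) :
  (A `<=` B)%fset ->
  \sum_(i <- B) F i = \sum_(i <- A) F i + \sum_(i <- (B `\` A)%fset) F i.
Proof.
move=> AB; rewrite (big_fsetID _ (mem A)) /=.
have -> : [fset i in B | i \in A]%fset = A.
  by apply/fsetP => i; rewrite !inE /= andb_idl// => /(fsubsetP AB).
have -> // : [fset i in B | i \notin A]%fset = (B `\` A)%fset.
by apply/fsetP => i; rewrite !inE andbC.
Qed.

Lemma esum_ge_fset {R : realType} (I : choiceType) (a : I -> R) (A : {fset I}) :
  ((\sum_(i <- A) a i)%:E <= \esum_(i in [set: I]) (a i)%:E)%E.
Proof.
apply: esum_ge; exists [set` A]; first by split=> //; exact: finite_fset.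
by rewrite fsbig_finite//= ?set_fsetK ?sumEFin//; exact: finite_fset.
Qed.

Lemma esum_fset_adherent {R : realType} (I : choiceType) (a : I -> R)
    (s e : R) :
  \esum_(i in [set: I]) (a i)%:E = s%:E -> 0 < e ->
  exists A : {fset I}, s - e < \sum_(i <- A) a i.
Proof.
move=> as_ e0; have : \esum_(i in [set: I]) (a i)%:E \is a fin_num.
  by rewrite as_.
move=> /(ub_ereal_sup_adherent e0) [_ [X [finX _] <-]].
rewrite -/(esum _ _) as_ fsbig_finite//= sumEFin -EFinB lte_fin => ?.
by exists (fset_set X).
Qed.

(** The hypothesis covers every finite set, hence also differences [B \ A]: small tails of [a] make
    the partial sums Cauchy. *)
Lemma sum_cvg_sq_le {R : realType} {k : scalar_kind} (H : hilbertType R k)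
    (I : choiceType) (x : I -> H) (a : I -> R) (D s : R) :
  0 < D ->
  (forall A : {fset I},
    hnorm (\sum_(i <- A) x i) ^+ 2 <= D * \sum_(i <- A) a i) ->
  \esum_(i in [set: I]) (a i)%:E = s%:E ->
  hnorm (sum x) ^+ 2 <= D * s.
Proof.
move=> D0 xa as_.
have sum_le (A : {fset I}) : \sum_(i <- A) a i <= s.
  by rewrite -lee_fin -as_; exact: esum_ge_fset.
have s0 : 0 <= s by have := sum_le fset0; rewrite big_seq_fset0.
have partialE (A : {fset I}) : partial_sum x A = \sum_(i <- A) x i.
  by rewrite big_seq_fsetE.
have totally_proper := @totally_filter I.
have x_cvg : cvg (partial_sum x @ totally).
  apply: hnorm_cauchy_cvg => e e0.
  (* A tail of [a] below [e^2 / D] gives a vector tail of norm below [e]. *)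
  have [A sA] := esum_fset_adherent as_ (divr_gt0 (exprn_gt0 2 e0) D0).
  exists (partial_sum x A); exists A => // B /= AB.
  rewrite !partialE (big_fsetD_sub _ AB) opprD addNKr hnorm_opp.
  rewrite -(@ltr_pXn2r _ 2) ?nnegrE ?hnorm_ge0 ?(ltW e0)//.
  rewrite (le_lt_trans (xa _))// mulrC -ltr_pdivlMr//.
  by have := sum_le B; rewrite (big_fsetD_sub _ AB); lra.
have Ds0 : 0 <= D * s by rewrite mulr_ge0// ltW.
rewrite -(sqr_sqrtr Ds0) ler_pXn2r ?nnegrE ?hnorm_ge0 ?sqrtr_ge0//.
rewrite -hnorm_opp -sub0r; apply: (hnorm_lim_le x_cvg).
exists fset0 => // B _ /=; rewrite partialE sub0r hnorm_opp.
rewrite -(@ler_pXn2r _ 2) ?nnegrE ?hnorm_ge0 ?sqrtr_ge0// sqr_sqrtr//.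
by rewrite (le_trans (xa _))// ler_pM2l.
Qed.

End Summation.

(** * Estimates for the frame operator *)

Section FrameOperator.
Set Implicit Arguments.
Unset Strict Implicit.
Context {R : realType} {k : scalar_kind}.
Local Notation proj := (@Defs.proj R k _).

Lemma rip_frame_term (H K : hilbertType R k) (T : {linear H -> H})
    (M : set H) (L : {linear H -> K}) (g : H) (y : K) : closed_subspace M ->
  let z := adjoint T (proj M (adjoint L y)) in
  rip g z = rip (L (proj M (T g))) y \/ rip g z = 0.
Proof.
move=> cM z; rewrite {}/z; set p := proj M (adjoint L y).
have [->|->] := rip_adjoint T g p; last by right; rewrite rip0r.
rewrite /p (rip_proj _ _ cM).
by have [->|->] := rip_adjoint L (proj M (T g)) y; [left|right; rewrite rip0r].
Qed.

(** This is [rip_le] with the weights split as [t w] and [v]; if an adjoint vanishes, only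
    nonnegativity of the right side is used. *)
Lemma rip_frame_term_le (H K : hilbertType R k) (T : {linear H -> H})
    (M : set H) (L : {linear H -> K}) (g : H) (y : K) (t v w : R) :
  closed_subspace M ->
  2 * (t * rip g (of_real k (v * w) *: adjoint T (proj M (adjoint L y)))) <=
  t ^+ 2 * (w ^+ 2 * hnorm (L (proj M (T g))) ^+ 2) + v ^+ 2 * hnorm y ^+ 2.
Proof.
move=> cM; rewrite rip_scaler.
have [->|->] := rip_frame_term T L g y cM; last first.
  by rewrite !mulr0; apply: addr_ge0; do ?[exact: sqr_ge0 | apply: mulr_ge0].
have := rip_le (of_real k (t * w) *: L (proj M (T g))) (of_real k v *: y).
by rewrite rip_scalel rip_scaler !hnorm_sqZ; lra.
Qed.

Context {H : hilbertType R k} {J : set int} {K : J -> hilbertType R k}.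

Lemma g_fusion_sumE (A : {linear H -> H}) (M : J -> set H)
    (L : forall j, {linear H -> K j}) (u : J -> R) (f : H) :
  g_fusion_sum A M L u f =
  \esum_(j in [set: J]) (u j ^+ 2 * hnorm (L j (proj (M j) (A f))) ^+ 2)%:E.
Proof. by apply: eq_esum => j _; rewrite -ripxx. Qed.

Lemma g_fusion_sum_ge0 (A : {linear H -> H}) (M : J -> set H)
    (L : forall j, {linear H -> K j}) (u : J -> R) (f : H) :
  (0 <= g_fusion_sum A M L u f)%E.
Proof.
by rewrite g_fusion_sumE; apply: esum_ge0 => j _;
  rewrite lee_fin mulr_ge0 ?sqr_ge0.
Qed.

Lemma frame_operator_sq_le (T U : {linear H -> H}) (W V : J -> set H)
    (L G : forall j, {linear H -> K j}) (w v : J -> R) (D s : R) (f : H) :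
  (forall j, closed_subspace (W j)) ->
  controlled_g_fusion_Bessel T W L w D ->
  g_fusion_sum U V G v f = s%:E ->
  hnorm (frame_operator T W L w U V G v f) ^+ 2 <= D * s.
Proof.
move=> cW [D0 L_Bessel]; rewrite g_fusion_sumE; apply: sum_cvg_sq_le => // A.
set x := \sum_(i <- A) _; set a := \sum_(i <- A) _.
pose b := \sum_(j <- A) w j ^+ 2 * hnorm (L j (proj (W j) (T x))) ^+ 2.
have b_le : b <= D * hnorm x ^+ 2.
  rewrite -lee_fin (le_trans _ (L_Bessel x))// g_fusion_sumE.
  exact: esum_ge_fset.
have : 2 * (D^-1 * rip x x) <= D^-1 ^+ 2 * b + a.
  (* Only the second [x] is expanded; the first stays the test vector, to which [b_le] applies. *)
  rewrite {2}/x rip_sumr !mulr_sumr -big_split /=.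
  by apply: ler_sum => j _; exact: rip_frame_term_le.
rewrite ripxx; set N := hnorm x ^+ 2 in b_le * => le_ba.
have Db : D^-1 ^+ 2 * b <= D^-1 * N.
  by rewrite expr2 -mulrA ler_pM2l ?invr_gt0// ler_pdivrMl.
rewrite -ler_pdivrMl//; move: le_ba Db; lra.
Qed.

End FrameOperator.

Theorem theorem4p5 (R : realType) (k : scalar_kind) (H : hilbertType R k)
  (Hsep : separable H)
  (J : set int) (K : J -> hilbertType R k)
  (W V : J -> set H) (w v : J -> R)
  (Lambda Gamma : forall j, {linear H -> K j})
  (W_closed : forall j, closed_subspace (W j))
  (V_closed : forall j, closed_subspace (V j))
  (w_gt0 : forall j, 0 < w j) (v_gt0 : forall j, 0 < v j)
  (Lambda_bounded : forall j, bounded_op (Lambda j))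
  (Gamma_bounded : forall j, bounded_op (Gamma j))
  (T U : {linear H -> H}) (T_GB : GB T) (U_GB : GB U)
  (D1 D2 : R)
  (Lambda_Bessel : controlled_g_fusion_Bessel T W Lambda w D1)
  (Gamma_Bessel : controlled_g_fusion_Bessel U V Gamma v D2)
  (lambda1 lambda2 : R) (lambda1_lt1 : lambda1 < 1) (lambda2_gtN1 : -1 < lambda2)
  (HS : forall f : H,
    hnorm (f - frame_operator T W Lambda w U V Gamma v f) <=
    lambda1 * hnorm f +
    lambda2 * hnorm (frame_operator T W Lambda w U V Gamma v f)) :
  controlled_g_fusion_frame U V Gamma v.
Proof.
have [D1_gt0 _] := Lambda_Bessel; have [_ Gamma_le] := Gamma_Bessel.
pose c := (1 - lambda1) / (1 + lambda2).
have l2 : 0 < 1 + lambda2 by lra.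
have c_gt0 : 0 < c by rewrite divr_gt0//; lra.
pose a := c ^+ 2 / D1.
have a_gt0 : 0 < a by rewrite divr_gt0// exprn_gt0.
(* The maximum secures [a <= b] even when [H] is trivial and [D2] is smaller than [a]. *)
exists a, (Num.max a D2); split=> //; first by rewrite le_max lexx.
move=> f; have sum_le := Gamma_le f; split; last first.
  by rewrite (le_trans sum_le)// lee_fin ler_wpM2r ?sqr_ge0// le_max lexx orbT.
have := g_fusion_sum_ge0 U V Gamma v f; move: sum_le.
(* The Bessel bound excludes [+oo], nonnegativity excludes [-oo]. *)
case sumE : (g_fusion_sum _ _ _ _ _) => [s| |] //= _ _.
have Sf_le := frame_operator_sq_le W_closed Lambda_Bessel sumE.
set Sf := frame_operator _ _ _ _ _ _ _ _ f in Sf_le.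
have f_le : c * hnorm f <= hnorm Sf.
  rewrite mulrAC ler_pdivrMr//.
  have := HS f; rewrite -/Sf => HSf.
  by have := ler_hnormD (f - Sf) Sf; rewrite subrK; lra.
rewrite lee_fin mulrAC ler_pdivrMr// [leRHS]mulrC (le_trans _ Sf_le)//.
rewrite -exprMn ler_pXn2r ?nnegrE ?hnorm_ge0// mulr_ge0 ?hnorm_ge0//.
exact: ltW.
Qed.
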